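(* Let $(T,X)$ be a minimal weakly almost periodic semiflow on a compact Hausdorff space $X$ with $T$ an amenable semigroup, such that for each $t\in T$ the map $x\mapsto tx$ is a bijection of $X$. Then $(T,X)$ is uniquely ergodic.
   Context: $X$ is a compact Hausdorff space. A semiflow $(T,X)$ consists of a topological semigroup $T$ with neutral element $e$ and a jointly continuous map $T\times X\to X$, $(t,x)\mapsto tx$, with $ex=x$ and $(ts)x=t(sx)$ for all $s,t\in T$, $x\in X$. $(T,X)$ is minimal if every orbit $Tx=\{tx:t\in T\}$, $x\in X$, is dense in $X$. $(T,X)$ is weakly almost periodic if for every $f\in C(X,\mathbb{R})$ the set $Tf=\{f_t : t\in T\}$, where $f_t(x)=f(tx)$, is relatively compact in $C(X,\mathbb{R})$ with the topology of pointwise convergence. A Borel probability measure $\mu$ on $X$ is invariant for $(T,X)$ if $\mu(B)=\mu(t^{-1}B)$ for all Borel subsets $B$ of $X$ and all $t\in T$, where $t^{-1}B=\{x\in X: tx\in B\}$. $(T,X)$ is uniquely ergodic if there is exactly one invariant Borel probability measure on $X$. A topological semigroup $T$ is amenable if every semiflow $(T,Y)$ on a compact Hausdorff space $Y$ admits an invariant Borel probability measure. *)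

(* Defs.v *)
From HB Require Import structures.
From mathcomp Require Import all_boot all_order all_algebra.
From mathcomp Require Import all_classical all_reals all_analysis.
Import numFieldNormedType.Exports.

Set Implicit Arguments.
Unset Strict Implicit.
Unset Printing Implicit Defensive.

Local Open Scope classical_set_scope.

(* Topological semigroup with neutral element; no separation axiom is assumed
   on the topology. *)
HB.mixin Record isTopologicalMonoid T & Topological T & Monoid T := {
  mulg_continuous : continuous (fun st : T * T => (st.1 * st.2)%g)
}.

#[short(type="topologicalMonoidType")]
HB.structure Definition TopologicalMonoid :=
  {T of Topological T & Monoid T & isTopologicalMonoid T}.

Record semiflow (T : topologicalMonoidType) (X : topologicalType) := Semiflow {
  act :> T -> X -> X ;
  act_continuous : continuous (fun tx : T * X => act tx.1 tx.2) ;
  act1 : forall x, act 1%g x = x ;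
  actM : forall t s x, act (t * s)%g x = act t (act s x)
}.

(* C(X, R) with the topology of pointwise convergence: the topology induced
   by the inclusion into the product space R^X. *)
Notation Cp X R :=
  (initial_topology (fun f : continuousType X R => (f : {ptws X -> R}))).

Section semiflow_properties.
Context (T : topologicalMonoidType) (X : topologicalType) (phi : semiflow T X).

Definition orbit (x : X) : set X := range (fun t => phi t x).

Definition minimal : Prop := forall x, dense (orbit x).

(* Every f \o phi t is continuous, so this is the whole family {f_t : t in T}. *)
Definition translates (R : realType) (f : continuousType X R) : set (Cp X R) :=
  [set g | exists t, (g : continuousType X R) = f \o phi t :> (X -> R)].

Definition weakly_almost_periodic (R : realType) : Prop :=
  forall f : continuousType X R, precompact (translates f).

End semiflow_properties.

(* For an X : ptopologicalType; pointedness only says that X is nonempty.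
   Borel measures are not required to be regular. *)
Notation borel X := (g_sigma_algebraType (@open X)).

Section invariant_measures.
Context (R : realType) (T : topologicalMonoidType) (X : ptopologicalType).
Context (phi : semiflow T X).

Definition invariant_measure (mu : probability (borel X) R) : Prop :=
  forall (t : T) (B : set (borel X)), measurable B ->
    mu B = mu ((phi t : X -> X) @^-1` B).

(* Two probabilities are the same when they agree on the Borel sets: the value
   of a library measure on a non-measurable set carries no information. *)
Definition uniquely_ergodic : Prop :=
  exists mu : probability (borel X) R, invariant_measure mu /\
    forall nu : probability (borel X) R, invariant_measure nu ->
      forall B : set (borel X), measurable B -> nu B = mu B.

End invariant_measures.

(* The compact spaces acted on have to be nonempty: the empty space carries no
   probability measure. *)
Definition amenable (R : realType) (T : topologicalMonoidType) : Prop :=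
  forall Y : ptopologicalType, compact [set: Y] -> hausdorff_space Y ->
  forall psi : semiflow T Y,
    exists mu : probability (borel Y) R, invariant_measure psi mu.

(* Main.v *)
Require Import Defs.
From mathcomp Require Import all_boot all_order all_algebra.
From mathcomp Require Import all_classical all_reals all_analysis.
From mathcomp Require Import measurable_realfun lra.
Import Order.TTheory GRing.Theory Num.Theory.
Import numFieldNormedType.Exports.

Set Implicit Arguments.
Unset Strict Implicit.
Unset Printing Implicit Defensive.

Local Open Scope classical_set_scope.
Local Open Scope ring_scope.

(** The enveloping semigroup [E], the closure of the action in [X^X], consists
    of continuous maps by weak almost periodicity and acts transitively by
    minimality. By Grothendieck's argument every [f \o p], [p] in [E], is a
    pointwise limit of a _sequence_ of translates along any subset of [E] that
    accumulates at [p], so by dominated convergence an invariant measure [mu]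
    is [E]-invariant on continuous functions, and the right-invariant
    pseudometrics [d_f(p, q) = int |f \o p - f \o q| dmu] are continuous on [E].
    They separate points since [mu] has full support, which makes [E] a compact
    topological group acting jointly continuously on [X]; equicontinuity and a
    convexity argument then show that [int f dmu] does not depend on [mu].

    As the measures need not be regular, this must still be carried from
    continuous functions to open sets [U]. Let [V] be an increasing union of
    cozero sets of functions [g_k] inside [U] exhausting the supremum of the
    measures of such cozero sets, and let [N] be the stabilizer of all the [g_k]
    in [E]. Then [V] is [N]-invariant, the open set [N U] is sigma-compact, and
    it is covered by [N]-translates of cozero subsets of [U], all of which are
    null outside [V]; hence [mu U = mu V] (the argument of Kakutani and Kodaira
    for the completion regularity of Haar measure). *)

(** * Limits along ultrafilters *)

Lemma fmap_ultra (T U : Type) (f : T -> U) (F : set_system T) :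
  UltraFilter F -> UltraFilter (f @ F).
Proof.
move=> FU; split; first exact: fmap_proper_filter.
move=> G GF FG; rewrite predeqE => A; split; last exact: FG.
move=> GA; have [//|FnA] := in_ultra_setVsetC (f @^-1` A) FU.
have GnA : G (~` A) by apply: FG; rewrite /fmap/= preimage_setC.
by have /filter_ex[x []] : G (A `&` ~` A) by exact: filterI.
Qed.

(** Since [A] is not in [F], the trace of [F] on the complement of [A] is proper. This starts many
    arguments by contradiction: along an ultrafilter living where a claim fails, compactness
    supplies limits. *)
Lemma ultra_setC (T : Type) (F : set_system T) (A : set T) :
  Filter F -> ~ F A -> exists G, [/\ UltraFilter G, F `<=` G & G (~` A)].
Proof.
move=> FF nFA.
have PF : ProperFilter (within (~` A) F).
  apply: Build_ProperFilter_ex => B; rewrite /within/= => FB.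
  apply: contrapT => nB; apply: nFA; near=> x.
  apply: contrapT => nAx; apply: nB; exists x.
  by apply: (near FB x) => //; exact: nAx.
have [G [GU sG]] := ultraFilterLemma PF.
exists G; split=> //.
- by move=> B FB; apply: sG; rewrite /within/=; apply: filterS FB.
- by apply: sG; rewrite /within/=; exact: nearW.
Unshelve. all: by end_near. Qed.

Lemma cvg_ultra (T : Type) (U : topologicalType) (F : set_system T)
    (u : T -> U) (l : U) : Filter F ->
  (forall G, UltraFilter G -> F `<=` G -> u @ G --> l) -> u @ F --> l.
Proof.
move=> FF h A lA; apply: contrapT => nFA.
have [G [GU FG GnA]] := ultra_setC FF nFA.
have GA : G (u @^-1` A) by exact: (h _ GU FG).
by have /filter_ex[x []] : G (u @^-1` A `&` ~` (u @^-1` A)) by exact: filterI.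
Qed.

Lemma compact_ultra_cvg (I : Type) (F : set_system I) (X : topologicalType)
    (u : I -> X) :
  compact [set: X] -> UltraFilter F -> exists x : X, u @ F --> x.
Proof.
rewrite compact_ultra => cX FU.
have [|x [_ ?]] := cX _ (fmap_ultra u FU); last by exists x.
by rewrite /fmap/=; exact: filterT.
Qed.

Lemma continuous_cvg_fmap (I : Type) (F : set_system I) (X Y : topologicalType)
    (f : X -> Y) (u : I -> X) (x : X) : Filter F ->
  continuous f -> u @ F --> x -> f (u i) @[i --> F] --> f x.
Proof. by move=> FF cf ux; apply: continuous_cvg => //; exact: cf. Qed.

Lemma cvg_fmap_unique (I : Type) (F : set_system I) (X : topologicalType)
    (u : I -> X) (x y : X) : hausdorff_space X -> ProperFilter F ->
  u @ F --> x -> u @ F --> y -> x = y.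
Proof. by move=> hX FF; apply: cvg_unique. Qed.

(** * Complete regularity of compact Hausdorff spaces *)

Section urysohn.
Context (R : realType) (X : ptopologicalType).
Hypothesis cX : compact [set: X].
Hypothesis hX : hausdorff_space X.

Lemma urysohn_point (U : set X) (x : X) : open U -> U x ->
  exists f : X -> R,
    [/\ continuous f, [set y | 0 < f y] `<=` U & 0 < f x].
Proof.
move=> oU Ux; have nX := compact_normal hX cX.
have /(@uniform_separatorP _ R)[f [cf f01 f0 f1]] :
    uniform_separator [set x] (~` U).
  apply: (@normal_completely_regular R) => //.
    exact: hausdorff_accessible.
  exact: open_closedC.
exists (fun y => 1 - f y); split.
- by move=> y; apply: cvgB; [exact: cvg_cst|exact: cf].
- move=> y; apply: contraPP => nUy; rewrite /= (_ : f y = 1) ?subrr ?ltxx//.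
  by apply: f1; exists y.
- by rewrite (_ : f x = 0) ?subr0 ?ltr01//; apply: f0; exists x.
Qed.

(** By [urysohn_point] the sets [0 < f] form a base of the topology, so continuous real functions
    detect convergence. *)
Lemma completely_regular_cvg (I : Type) (F : set_system I) (u : I -> X)
    (x : X) : Filter F ->
  (forall f : X -> R, continuous f -> f (u i) @[i --> F] --> f x) ->
  u @ F --> x.
Proof.
move=> FF cfu N; rewrite nbhsE => -[B [oB Bx] BN].
have [f [cf fB fx]] := urysohn_point oB Bx.
have Fu : F [set i | 0 < f (u i)].
  apply: (cfu f cf [set r | 0 < r]).
  by apply: open_nbhs_nbhs; split=> //; exact: open_gt.
by change (F (u @^-1` N)); apply: filterS Fu => i fui; apply/BN/fB.
Qed.

End urysohn.

(** * The enveloping semigroup *)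

Notation ptcvg F a p := (forall x, a%FUN ^~ x @ F --> p x).

Section enveloping_semigroup.
Context (T : topologicalMonoidType) (X : ptopologicalType) (phi : semiflow T X).
Hypothesis cX : compact [set: X].
Hypothesis hX : hausdorff_space X.

Definition envelope : set (X -> X) :=
  closure (range (fun t => phi t : {ptws X -> X})).

Local Notation E := envelope.

Lemma act_cts t : continuous (phi t).
Proof.
move=> x; have := @cvg_comp _ _ _
  (fun y : X => (t, y)) (fun tx : T * X => phi tx.1 tx.2)
  (nbhs x) (nbhs (t, x)) (nbhs (phi t x)).
apply; last exact: (@act_continuous T X phi (t, x)).
by apply: cvg_pair; [exact: cvg_cst|exact: cvg_id].
Qed.

Lemma ptcvgP (I : Type) (F : set_system I) (a : I -> X -> X) (p : X -> X) :
  Filter F ->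
  ptcvg F a p <-> a @ F --> (p : {ptws X -> X}).
Proof.
move=> FF; split=> [ap|ap x].
  apply/cvg_sup => x A [_ [[B oB <-] Bpx BA]].
  by apply: filterS BA _; apply: ap; exact: open_nbhs_nbhs.
exact: (cvg_comp _ _ ap (@proj_continuous X (fun=> X) x p)).
Qed.

Lemma envelope_act t : E (phi t).
Proof. by apply: subset_closure; exists t. Qed.

Lemma envelope_closed (I : Type) (F : set_system I) (a : I -> X -> X)
    (p : X -> X) :
  ProperFilter F -> (forall i, E (a i)) -> ptcvg F a p -> E p.
Proof.
move=> FF Ea /ptcvgP ap.
have cE : closed (E : set {ptws X -> X}) by exact: closed_closure.
apply: cE => N /ap FN.
have /filter_ex[i Ni] : F (a @^-1` N) by exact: FN.
by exists (a i).
Qed.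

Lemma envelope_ultra (I : Type) (F : set_system I) (a : I -> X -> X) :
  UltraFilter F -> (forall i, E (a i)) -> exists2 p, E p & ptcvg F a p.
Proof.
move=> FU Ea.
have cW : compact [set: {ptws X -> X}].
  have := @tychonoff X (fun=> X) (fun=> setT) (fun=> cX).
  by congr compact; apply/seteqP; split.
have [p ap] := @compact_ultra_cvg _ _ {ptws X -> X} a cW FU.
have ap' : ptcvg F a p by apply/ptcvgP.
by exists p => //; exact: (envelope_closed _ Ea ap').
Qed.

(** The sets of times [t] with [phi t] in a given neighbourhood of [p] are nonempty because [p] is a
    closure point; an ultrafilter containing all of them serves. *)
Lemma envelope_net p : E p -> exists F : set_system T,
  UltraFilter F /\ ptcvg F (fun t => phi t) p.
Proof.
move=> Ep.
pose G := filter_from (nbhs (p : {ptws X -> X})) (fun N => [set t | N (phi t)]).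
have GF : ProperFilter G.
  apply: filter_from_proper; last first.
    by move=> N /Ep[_ [[t _ <-] Nt]]; exists t.
  apply: filter_from_filter; first by exists setT; exact: filterT.
  by move=> A B nA nB; exists (A `&` B); [exact: filterI|].
have [F [FU GF']] := ultraFilterLemma GF.
exists F; split=> //; apply/ptcvgP => N nN.
by apply: GF'; exists N.
Qed.

Lemma envelope_id : E id.
Proof.
by have := @envelope_act 1%g; congr (E _); apply/funext => x; rewrite act1.
Qed.

Lemma envelope_actM t p : E p -> E (phi t \o p).
Proof.
move=> /envelope_net[F [FU Fp]].
apply: (@envelope_closed _ F (fun s => phi (t * s)%g)).
- by move=> s; exact: envelope_act.
- move=> x; rewrite /=; under eq_fun do rewrite actM.
  by apply: continuous_cvg_fmap (Fp x); exact: act_cts.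
Qed.

(** Composition is pointwise continuous in the left factor for arbitrary maps, but in the right
    factor only behind a continuous map. Hence [envelope_actM] passes to the limit behind [phi t]
    first, and the limit in [t] is taken here. *)
Lemma envelopeM p q : E p -> E q -> E (p \o q).
Proof.
move=> /envelope_net[F [FU Fp]] Eq.
apply: (@envelope_closed _ F (fun s => phi s \o q)).
- by move=> s; exact: envelope_actM.
- by move=> x; exact: Fp.
Qed.

(** By density of the orbit, some ultrafilter of times drives [x] to [y]; a limit of the action
    along it is the required map. *)
Lemma envelope_transitive x y : minimal phi -> exists2 p, E p & p x = y.
Proof.
move=> /(_ x) dx.
pose G := filter_from (nbhs y) (fun N => [set t | N (phi t x)]).
have GF : ProperFilter G.
  apply: filter_from_proper; last first.
    move=> N; rewrite nbhsE => -[B [oB By] BN].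
    have [|z [Bz [t _ tz]]] := dx B _ oB; first by exists y.
    by exists t; apply: BN; rewrite /= tz.
  apply: filter_from_filter; first by exists setT; exact: filterT.
  by move=> A B nA nB; exists (A `&` B); [exact: filterI|].
have [F [FU GF']] := ultraFilterLemma GF.
have [p Ep Fp] := envelope_ultra FU envelope_act.
exists p => //; apply: (cvg_fmap_unique hX _ (Fp x)).
by move=> N nN; apply: GF'; exists N.
Qed.

(** Along an ultrafilter of times tending to [p], the translates of [f] converge in [Cp X R] to a
    continuous function by weak almost periodicity, and pointwise to [f \o p]. So [f \o p] is
    continuous for every continuous [f], which suffices by complete regularity. *)
Lemma envelope_cts (R : realType) p :
  weakly_almost_periodic phi R -> E p -> continuous p.
Proof.
move=> wap /envelope_net[F [FU Fp]] x; apply: (@completely_regular_cvg R _ cX hX) => f cf.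
suff : continuous (f \o p) by exact.
pose h t : Cp X R := mkcts (fun y => cvg_comp _ _ (@act_cts t y) (cf (phi t y))).
have := wap (mkcts cf); rewrite precompactE compact_ultra.
move=> /(_ (h @ F) (fmap_ultra h FU))[|g [_ hg]].
  apply: (@filterS _ F _ setT) => [t _|]; last exact: filterT.
  by apply: subset_closure; exists t.
suff -> : f \o p = (g : continuousType X R) by exact: cts_fun.
apply/funext => y.
apply: (@cvg_fmap_unique _ F _ (fun t => f (phi t y))).
- exact: Rhausdorff.
- exact: continuous_cvg_fmap (Fp y).
pose ev (k : Cp X R) : R := (k : continuousType X R) y.
have cev : continuous ev.
  pose iota (k : Cp X R) : {ptws X -> R} := (k : continuousType X R).
  have ciota : continuous iota by exact: initial_continuous.
  move=> k.
  exact: (cvg_comp _ _ (ciota k) (@proj_continuous X (fun=> R) y (iota k))).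
exact: (cvg_comp _ _ hg (cev g)).
Qed.

End enveloping_semigroup.

(** * Grothendieck's extraction of sequences *)

Lemma filter_all_in (I : eqType) (T : Type) (F : set_system T) (l : seq I)
    (P : I -> set T) : Filter F ->
  (forall h, h \in l -> F (P h)) -> F [set x | forall h, h \in l -> P h x].
Proof.
move=> FF; elim: l => [|h l IH] FP; first by apply: filterS filterT => x _ h.
have Fh : F (P h) by apply: FP; rewrite mem_head.
have Fl : F [set x | forall h, h \in l -> P h x].
  by apply: IH => k kl; apply: FP; rewrite in_cons kl orbT.
near=> x => k; rewrite in_cons => /predU1P[->|]; first by near: x.
by move: k; near: x.
Unshelve. all: by end_near. Qed.

Section angelic.
Context (R : realType) (X : ptopologicalType).
Hypothesis cX : compact [set: X].

Lemma finite_subcover (B : X -> set X) : (forall x, nbhs x (B x)) ->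
  exists s : seq X, forall x, exists2 y, y \in s & B y x.
Proof.
move=> nB; have := cX; rewrite compact_cover => /(_ _ setT (fun x => (B x)^°)).
case=> [x _|x _|D _ sD]; [exact: open_interior|by exists x => //; exact: nB|].
exists (finmap.enum_fset D) => x; have [y /= yD Byx] := sD x Logic.I.
by exists y => //; exact: interior_subset Byx.
Qed.

Lemma finite_net (l : seq (X -> R)) (e : R) :
  (forall h, h \in l -> continuous h) -> 0 < e ->
  exists s : seq X, forall x, exists2 y, y \in s &
    forall h, h \in l -> `|h x - h y| < e.
Proof.
move=> cl e0.
apply: (@finite_subcover (fun y => [set x | forall h, h \in l -> `|h x - h y| < e])).
move=> y; apply: filter_all_in => h /cl/(_ y)/cvgrPdist_lt/(_ e e0).
by apply: filterS => x; rewrite distrC.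
Qed.

(* Grothendieck: in a compact set [K] of continuous functions, pointwise closure
   points of [A] are limits of sequences of [A]. *)
Variables (K A : set (X -> R)) (g : X -> R).
Hypothesis Kcts : forall h, K h -> continuous h.
Hypothesis AK : A `<=` K.
Hypothesis Kg : K g.
Hypothesis K_ultra : forall F : set_system nat, UltraFilter F ->
  forall a : nat -> X -> R, (forall n, K (a n)) -> exists2 h, K h & ptcvg F a h.
Hypothesis gA : forall (s : seq X) (e : R), 0 < e ->
  exists2 h, A h & forall x, x \in s -> `|h x - g x| < e.

Lemma angelic : exists2 a : nat -> X -> R, (forall n, A (a n)) & ptcvg \oo a g.
Proof.
(* Diagonal construction: the [n]-th function is close to [g] on finitely many
   points that are eps-dense for [g] and for the functions chosen before. *)
pose eps (n : nat) : R := n.+1%:R^-1.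
have eps0 n : 0 < eps n by rewrite invr_gt0.
have /choice[S SP] : forall ln : seq (X -> R) * nat, exists s : seq X,
    (forall h, h \in ln.1 -> continuous h) ->
    forall x, exists2 y, y \in s & forall h, h \in ln.1 -> `|h x - h y| < eps ln.2.
  case=> l n /=; have [cl|ncl] := pselect (forall h, h \in l -> continuous h).
    by have [s sP] := finite_net cl (eps0 n); exists s.
  by exists [::].
have /choice[nxt nxtP] : forall sn : seq X * nat, exists h, A h /\
    forall x, x \in sn.1 -> `|h x - g x| < eps sn.2.
  by case=> s n /=; have [h Ah hP] := gA s (eps0 n); exists h.
(* At stage [n] the functions are [g] and [a 0, ..., a (n-1)]. The points of stage [n.+1] are
   [eps n]-dense for these functions, and [a n] is then chosen [eps n]-close to [g] on those
   points. *)
pose step (st : seq (X -> R) * seq X) n :=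
  let s := st.2 ++ S (st.1, n) in (nxt (s, n) :: st.1, s).
pose st := fix st n := if n is m.+1 then step (st m) m else ([:: g], [::]).
pose a n := nxt ((st n.+1).2, n).
have Aa n : A (a n) by have [] := nxtP ((st n.+1).2, n).
have stg n : g \in (st n).1.
  by elim: n => [|n IH]; rewrite /= in_cons ?eqxx ?IH ?orbT.
have sta n i : (i < n)%N -> a i \in (st n).1.
  elim: n => // n IH; rewrite ltnS leq_eqVlt => /predU1P[->|/IH].
    by rewrite /= mem_head.
  by rewrite /= in_cons => ->; rewrite orbT.
have stc n h : h \in (st n).1 -> continuous h.
  elim: n h => [|n IH] h; first by rewrite inE => /eqP ->; exact: Kcts.
  rewrite /= in_cons => /predU1P[->|/IH//]; apply: Kcts; apply: AK.
  by have [] := nxtP ((st n).2 ++ S ((st n).1, n), n).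
have st_mono m n : (m <= n)%N -> {subset (st m).2 <= (st n).2}.
  elim: n => [|n IH]; first by rewrite leqn0 => /eqP ->.
  rewrite leq_eqVlt => /predU1P[->//|/IH mn] x /mn.
  by rewrite /= mem_cat => ->.
have ag n x : x \in (st n.+1).2 -> `|a n x - g x| < eps n.
  by have [_] := nxtP ((st n.+1).2, n); exact.
exists a => // x; apply: cvg_ultra => F FU Foo.
have [h Kh ah] := K_ultra FU (fun n => AK (Aa n)).
suff <- : h x = g x by exact: ah.
(* A point once selected stays selected, so every later [a m] is within [eps m] of [g] there. *)
have hst n y : y \in (st n).2 -> h y = g y.
  move=> yn; apply: (@cvg_fmap_unique _ F _ (a ^~ y)); [exact: Rhausdorff|exact: ah|].
  apply/cvgrPdist_lt => e e0; apply: Foo.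
  near=> m; rewrite distrC; apply: lt_trans (ag m y _) _.
    apply: st_mono yn; apply: leqW; near: m; exact: nbhs_infty_ge.
  by near: m; exact: near_infty_natSinv_lt (PosNum e0).
(* The selected points [y n] imitate [x] for all functions of stage [n]. Hence at their limit [z]
   along [F], both [g] and every [a n] take the value they have at [x]. *)
have /choice[y yP] : forall n, exists y, y \in (st n.+1).2 /\
    forall h, h \in (st n).1 -> `|h x - h y| < eps n.
  move=> n; have [y yS yP] := SP ((st n).1, n) (@stc n) x.
  by exists y; split=> //=; rewrite mem_cat yS orbT.
have [z yz] := compact_ultra_cvg y cX FU.
have eqz k m : (forall n, (m <= n)%N -> k \in (st n).1) -> continuous k -> k x = k z.
  move=> kst ck; apply: (@cvg_fmap_unique _ F _ (k \o y)) => //.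
  - apply/cvgrPdist_lt => e e0; apply: Foo.
    near=> n; apply: lt_trans (proj2 (yP n) k (kst n _)) _.
      by near: n; exact: nbhs_infty_ge.
    by near: n; exact: near_infty_natSinv_lt (PosNum e0).
  - exact: continuous_cvg_fmap.
have gz : g x = g z by apply: (eqz g 0%N) => //; exact: Kcts.
have az n : a n x = a n z.
  by apply: (eqz _ n.+1); [move=> k; exact: sta|exact/Kcts/AK].
(* The value of [h] at [x] and at [z] is the same limit of the [a n]; and [h z = g z] because the
   continuous functions [h] and [g] agree at all the [y n]. *)
rewrite gz; transitivity (h z).
  apply: (@cvg_fmap_unique _ F _ (a ^~ x)); [exact: Rhausdorff|exact: ah|].
  by under eq_fun do rewrite az; exact: ah.
apply: (@cvg_fmap_unique _ F _ (h \o y)); first exact: Rhausdorff.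
  exact: continuous_cvg_fmap (Kcts Kh) yz.
have -> : h \o y = g \o y.
  by apply/funext => n /=; apply: (hst n.+1); exact: (proj1 (yP n)).
exact: continuous_cvg_fmap (Kcts Kg) yz.
Unshelve. all: by end_near. Qed.

End angelic.

(** * Borel sets, null sets and integrals *)

Section borel.
Context (X : ptopologicalType).

Lemma open_borel (B : set X) : open B -> measurable (B : set (borel X)).
Proof. by move=> oB; exact: sub_sigma_algebra. Qed.

Lemma cts_borel (f : X -> X) : continuous f ->
  measurable_fun setT (f : borel X -> borel X).
Proof.
move=> /continuousP cf.
apply: (@measurability _ _ (borel X) (borel X) setT f (@open X)) => //.
by move=> _ [B oB <-]; rewrite setTI; apply: open_borel; exact: cf.
Qed.

Lemma cts_preimage_borel (f : X -> X) (B : set X) : continuous f ->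
  measurable (B : set (borel X)) -> measurable (f @^-1` B : set (borel X)).
Proof.
by move=> /cts_borel mf mB; rewrite -[X in measurable X]setTI; exact: mf.
Qed.

Lemma cts_borelR (R : realType) (f : X -> R) : continuous f ->
  measurable_fun setT (f : borel X -> R).
Proof.
move=> /continuousP cf; apply: (measurability _ (RGenOpens.measurableE R)).
move=> _ [_ [a [b ->] <-]]; rewrite setTI; apply: open_borel.
exact/cf/interval_open.
Qed.

End borel.

Lemma probability_setT_negligible d (Y : measurableType d) (R : realType)
  (P : probability Y R) : ~ P.-negligible [set: Y].
Proof.
move=> /(measure_negligible measurableT); rewrite [X in X = _](probability_setT P).
by move/eqP; rewrite gt_eqF// lte01.
Qed.

Lemma Rintegral_probability_cst d (Y : measurableType d) (R : realType)
  (P : probability Y R) (c : R) : Rintegral P setT (fun=> c) = c.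
Proof.
rewrite Rintegral_cst//.
have -> : (P : {measure set Y -> \bar R}) setT = 1%E by exact: probability_setT.
by rewrite mulr1.
Qed.

Lemma cts_min (R : realType) (Y : topologicalType) (f g : Y -> R) :
  continuous f -> continuous g -> continuous (fun x => Num.min (f x) (g x)).
Proof. by move=> cf cg x; exact: (continuous_min (cf x) (cg x)). Qed.

Lemma cts_max (R : realType) (Y : topologicalType) (f g : Y -> R) :
  continuous f -> continuous g -> continuous (fun x => Num.max (f x) (g x)).
Proof. by move=> cf cg x; exact: (continuous_max (cf x) (cg x)). Qed.

Lemma Rintegral_preserving d (Y : measurableType d) (R : realType)
    (P : probability Y R) (h : Y -> Y) (f : Y -> R) :
  measurable_fun setT h -> measurable_fun setT f ->
  P.-integrable setT (EFin \o (f \o h)) ->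
  (forall B, measurable B -> P B = P (h @^-1` B)) ->
  Rintegral P setT (f \o h) = Rintegral P setT f.
Proof.
move=> mh mf iP hP; rewrite /Rintegral; congr fine.
transitivity (\int[pushforward P h]_x (f x)%:E)%E.
  by rewrite (integral_pushforward mh)//; apply/measurable_EFinP.
by apply: eq_measure_integral => B mB _; exact/esym/hP.
Qed.

Lemma negligible_seq d (Y : measurableType d) (R : realType)
    (P : {measure set Y -> \bar R}) (I : eqType) (s : seq I) (B : I -> set Y)
    (A : set Y) :
  (forall i, i \in s -> P.-negligible (B i)) ->
  (forall x, A x -> exists2 i, i \in s & B i x) -> P.-negligible A.
Proof.
elim: s A => [|i s IH] A sB AB.
  suff -> : A = set0 by exact: negligible_set0.
  by apply/seteqP; split=> x // /AB[].
apply: (@negligibleS _ _ _ _ (B i `|` (A `\` B i))).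
  by move=> x Ax; have [|] := pselect (B i x); [left|right].
apply: negligibleU; first by apply: sB; rewrite mem_head.
apply: IH => [j js|x [/AB[j]]]; first by apply: sB; rewrite in_cons js orbT.
by rewrite in_cons => /predU1P[->//|js Bj _]; exists j.
Qed.

Lemma Rintegral_eq0_negligible d (Y : measurableType d) (R : realType)
    (P : probability Y R) (f : Y -> R) :
  P.-integrable setT (EFin \o f) -> (forall y, 0 <= f y) ->
  Rintegral P setT f = 0 -> P.-negligible [set y | 0 < f y].
Proof.
move=> intf f0 intf0.
have mf : measurable_fun setT (EFin \o f) by exact: (measurable_int P).
have /(ae_eq_integral_abs P measurableT mf) : (\int[P]_x `|(EFin \o f) x| = 0)%E.
  rewrite -[0%E]/(0%:E) -intf0 /Rintegral fineK; last exact: integrable_fin_num.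
  by apply: eq_integral => x _; rewrite gee0_abs// lee_fin.
apply: negligibleS => y /= fy /(_ Logic.I)[] fy0.
by move: fy; rewrite fy0 ltxx.
Qed.

(** * Integrals of continuous functions *)

Section mean.
Context (R : realType) (X : ptopologicalType).
Hypothesis cX : compact [set: X].

Lemma cts_bounded (f : X -> R) : continuous f -> exists2 M, 0 < M & forall x, `|f x| <= M.
Proof.
move=> cf; have /compact_bounded[M [_ MP]] : compact (f @` setT).
  by apply: continuous_compact => //; exact: continuous_subspaceT.
exists (`|M| + 1); first by rewrite ltr_wpDl.
move=> x; apply: MP; last by exists x.
by rewrite (le_lt_trans (ler_norm M)) // ltrDl.
Qed.

Definition mean (mu : probability (borel X) R) (f : X -> R) : R :=
  Rintegral mu setT (f : borel X -> R).

Context (mu : probability (borel X) R).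

Lemma cts_integrable (f : X -> R) : continuous f ->
  mu.-integrable setT (EFin \o (f : borel X -> R)).
Proof.
move=> cf; apply: measurable_bounded_integrable => //.
- exact: fin_num_fun_lty.
- exact: cts_borelR.
- have [M M0 fM] := cts_bounded cf; exists M; split; first exact: num_real.
  by move=> r Mr x _; exact: (le_trans (fM x)) (ltW Mr).
Qed.

Lemma meanD (f g : X -> R) : continuous f -> continuous g ->
  mean mu (fun x => f x + g x) = mean mu f + mean mu g.
Proof. by move=> cf cg; rewrite /mean RintegralD//; exact: cts_integrable. Qed.

Lemma meanZ (c : R) (f : X -> R) : continuous f ->
  mean mu (fun x => c * f x) = c * mean mu f.
Proof. by move=> cf; rewrite /mean RintegralZl//; exact: cts_integrable. Qed.

Lemma mean_cst c : mean mu (fun=> c) = c.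
Proof. exact: Rintegral_probability_cst.
Qed.

Lemma le_mean (f g : X -> R) : continuous f -> continuous g ->
  (forall x, f x <= g x) -> mean mu f <= mean mu g.
Proof. by move=> cf cg fg; apply: le_Rintegral => //; exact: cts_integrable. Qed.

Lemma mean_cvg (a : nat -> X -> R) (g : X -> R) (M : R) :
  (forall n, continuous (a n)) -> measurable_fun setT (g : borel X -> R) ->
  (forall n x, `|a n x| <= M) -> ptcvg \oo a g ->
  mean mu (a n) @[n --> \oo] --> mean mu g.
Proof.
move=> ca mg aM ag.
have iM : mu.-integrable setT (EFin \o (fun=> M : R)).
  apply: measurable_bounded_integrable => //; first exact: fin_num_fun_lty.
  exact: bounded_cst.
have [|||//||ig _ ] := @dominated_convergence _ (borel X) R mu setT measurableT
  (fun n => EFin \o a n) (EFin \o g) (EFin \o fun=> M).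
- by move=> n; apply/measurable_EFinP; exact: cts_borelR.
- exact/measurable_EFinP.
- by apply: aeW => x _; apply: cvg_EFin; [exact: nearW|exact: ag].
- by apply: aeW => x n _; rewrite /= lee_fin.
- move=> ?; apply: fine_cvg; rewrite fineK//.
  exact: integrable_fin_num.
Qed.

Lemma mean_indic (B : set X) : measurable (B : set (borel X)) ->
  mean mu \1_B = fine (mu B).
Proof.
by move=> mB; rewrite /mean /Rintegral integral_indic// setIT.
Qed.

End mean.

(** * Measures of cozero sets *)

Section cozero.
Context (R : realType) (X : ptopologicalType).
Hypothesis cX : compact [set: X].

Definition cozero (g : X -> R) : set X := [set x | 0 < g x].

Lemma cozero_open g : continuous g -> open (cozero g).
Proof. by move=> /continuousP/(_ [set r | 0 < r]); apply; exact: open_gt. Qed.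

Lemma cozero_borel g : continuous g -> measurable (cozero g : set (borel X)).
Proof. by move=> cg; apply: open_borel; exact: cozero_open. Qed.

Lemma cozero_max g h : cozero (g \max h) = cozero g `|` cozero h.
Proof.
apply/seteqP; split=> x; rewrite /cozero /= lt_max; first by move/orP.
by move=> gh; apply/orP.
Qed.

(** The indicator of [cozero g] is the bounded pointwise limit of the continuous functions
    [u n \o g], where [u n] is the ramp of slope [n] from 0 to 1; dominated convergence
    concludes. *)
Lemma eq_cozero (mu nu : probability (borel X) R) (g h : X -> R) :
  continuous g -> continuous h ->
  (forall u : R -> R, continuous u -> mean mu (u \o g) = mean nu (u \o h)) ->
  mu (cozero g) = nu (cozero h).
Proof.
move=> cg ch ugh.
pose u n (r : R) := Num.min 1 (n%:R * Num.max r 0).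
have cu n : continuous (u n).
  apply: cts_min; first exact: cst_continuous.
  have cm : continuous (fun r : R => Num.max r 0).
    by apply: cts_max; [exact: (fun=> cvg_id)|exact: cst_continuous].
  by move=> r; apply: cvgM; [exact: cvg_cst|exact: cm].
have u1 n r : `|u n r| <= 1.
  rewrite ger0_norm ?ge_min ?lexx// le_min ler01 mulr_ge0//.
  by rewrite le_max lexx orbT.
have uc k : ptcvg \oo (fun n => u n \o k) (\1_(cozero k) : X -> R).
  move=> x; rewrite /= indicE; have [k0|k0] := ltP 0 (k x).
    rewrite mem_set//; apply: cvg_near_cst; near=> n.
    rewrite /u (max_l (ltW k0)); apply/min_idPl.
    rewrite -ler_pdivrMr// mul1r; near: n; exact: nbhs_infty_ger.
  rewrite memNset; last by rewrite /cozero /= ltNge k0.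
  by apply: cvg_near_cst; near=> n; rewrite /u (max_r k0) mulr0; apply/min_idPr.
have main (m : probability (borel X) R) k : continuous k ->
    mean m (u n \o k) @[n --> \oo] --> fine (m (cozero k)).
  move=> ck; rewrite -mean_indic; last exact: cozero_borel.
  apply: (@mean_cvg _ _ m _ _ 1) => //.
  - by move=> n x; apply: continuous_comp; [exact: ck|exact: cu].
  - by apply: measurable_indic; exact: cozero_borel.
  - by move=> n x; exact: u1.
have /= mg := main mu _ cg; have /= mh := main nu _ ch.
rewrite -[LHS]fineK; last exact: fin_num_measure (cozero_borel cg).
rewrite -[RHS]fineK; last exact: fin_num_measure (cozero_borel ch).
congr EFin; apply: (@cvg_fmap_unique _ \oo _ (fun n => mean mu (u n \o g))) => //.
by under eq_fun do rewrite ugh//.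
Unshelve. all: by end_near. Qed.

End cozero.

(** * Invariance and full support *)

Section invariant.
Context (R : realType) (T : topologicalMonoidType) (X : ptopologicalType).
Context (phi : semiflow T X) (mu : probability (borel X) R).
Hypothesis cX : compact [set: X].
Hypothesis mu_inv : invariant_measure phi mu.

Lemma mean_act t (f : X -> R) : continuous f -> mean mu (f \o phi t) = mean mu f.
Proof.
move=> cf; apply: Rintegral_preserving.
- by apply: cts_borel; exact: act_cts.
- exact: cts_borelR.
- apply: (@cts_integrable _ _ cX mu (f \o phi t)) => x.
  by apply: continuous_comp; [exact: act_cts|exact: cf].
- by move=> B mB; exact: mu_inv.
Qed.

(** If the mean vanished, [cozero f] would be null. By minimality and compactness finitely many of
    its preimages under the action cover [X], and they are null by invariance. *)
Lemma mean_gt0 (f : X -> R) x : minimal phi ->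
  continuous f -> (forall y, 0 <= f y) -> 0 < f x -> 0 < mean mu f.
Proof.
move=> min_phi cf f0 fx.
rewrite lt_neqAle Rintegral_ge0// andbT eq_sym; apply/eqP => mf0.
have O0 : mu.-negligible (cozero f : set (borel X)).
  exact: (Rintegral_eq0_negligible (cts_integrable cX mu cf)).
have mO : measurable (cozero f : set (borel X)) by exact: cozero_borel.
have /choice[t tP] : forall y, exists t, cozero f (phi t y).
  move=> y; have [||z [fz [t _ tyz]]] := min_phi y (cozero f).
  - by exists x.
  - exact: cozero_open.
  - by exists t; rewrite /= tyz.
have [|s sP] := @finite_subcover _ cX (fun y => phi (t y) @^-1` cozero f).
  move=> y; apply: (@act_cts _ _ phi (t y)); apply: open_nbhs_nbhs.
  by split; [exact: cozero_open|exact: (tP y)].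
have : mu.-negligible [set: borel X].
  apply: (@negligible_seq _ (borel X) R mu X s (fun y => phi (t y) @^-1` cozero f)) => //.
  move=> y _.
  have mB : measurable (phi (t y) @^-1` cozero f : set (borel X)).
    by apply: cts_preimage_borel mO; exact: act_cts.
  apply/(negligibleP _ mB).
  by rewrite -[LHS](mu_inv (t y) mO); exact: measure_negligible O0.
exact: probability_setT_negligible.
Qed.

End invariant.

(** * The envelope as a compact topological group *)

Lemma cts_comp (X Y Z : topologicalType) (f : X -> Y) (g : Y -> Z) :
  continuous f -> continuous g -> continuous (g \o f).
Proof. by move=> cf cg x; apply: continuous_comp; [exact: cf|exact: cg]. Qed.

Lemma cts_dist (R : realType) (X : topologicalType) (f g : X -> R) :
  continuous f -> continuous g -> continuous (fun x => `|f x - g x|).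
Proof. by move=> cf cg x; apply: cvg_norm; apply: cvgB; [exact: cf|exact: cg]. Qed.

Section envelope_group.
Context (R : realType) (T : topologicalMonoidType) (X : ptopologicalType).
Context (phi : semiflow T X) (mu : probability (borel X) R).
Hypothesis cX : compact [set: X].
Hypothesis hX : hausdorff_space X.
Hypothesis min_phi : minimal phi.
Hypothesis wap_phi : weakly_almost_periodic phi R.
Hypothesis mu_inv : invariant_measure phi mu.

Local Notation E := (envelope phi).

Let ctsE p : E p -> continuous p.
Proof. exact: envelope_cts. Qed.

(** Dominated convergence holds for sequences, not along ultrafilters. If convergence failed,
    [angelic] would extract from the bad indices a sequence tending to [f \o p], whose means do
    converge. *)
Lemma mean_dist_cvg (I : Type) (F : set_system I) (a : I -> X -> X) (p : X -> X)
    (f k : X -> R) :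
  UltraFilter F -> (forall i, E (a i)) -> E p -> ptcvg F a p ->
  continuous f -> continuous k ->
  mean mu (fun x => `|f (a i x) - k x|) @[i --> F] -->
  mean mu (fun x => `|f (p x) - k x|).
Proof.
move=> FU Ea Ep ap cf ck; apply/cvgrPdist_lt => e e0.
pose D := [set i | `|mean mu (fun x => `|f (p x) - k x|) -
  mean mu (fun x => `|f (a i x) - k x|)| < e].
change (F D); have [//|FnD] := in_ultra_setVsetC D FU.
(* [A] uses only the bad indices; as [F] contains their set, [f \o p] is still in the pointwise
   closure of [A]. *)
pose K := [set f \o q | q in E]; pose A := [set f \o a i | i in ~` D].
have cK h : K h -> continuous h.
  by move=> [q Eq <-]; apply: cts_comp => //; exact: ctsE.
have [||||b bA bcvg] := @angelic R X cX K A (f \o p) cK.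
- by move=> _ [i _ <-]; exists (a i).
- by exists p.
- move=> G GU b Kb.
  have /choice[q qP] : forall n, exists q, E q /\ f \o q = b n.
    by move=> n; have [q Eq qb] := Kb n; exists q.
  have [r Er qr] := envelope_ultra cX GU (fun n => proj1 (qP n)).
  exists (f \o r); first by exists r.
  move=> x; under eq_fun do rewrite -(proj2 (qP _)).
  exact: continuous_cvg_fmap (qr x).
- move=> s d d0.
  have Fs : F [set i | forall x, x \in s -> `|f (a i x) - f (p x)| < d].
    apply: filter_all_in => x _.
    have /cvgrPdist_lt/(_ d d0) : f (a i x) @[i --> F] --> f (p x).
      by apply: continuous_cvg_fmap (ap x).
    by apply: filterS => i; rewrite distrC.
  have /filter_ex[i [Di ai]] : F (~` D `&`
      [set i | forall x, x \in s -> `|f (a i x) - f (p x)| < d]).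
    exact: filterI.
  by exists (f \o a i) => //; exists i.
have bcts n : continuous (b n).
  by have [i _ <-] := bA n; apply: cts_comp => //; exact: ctsE.
have [Mf _ fM] := cts_bounded cX cf; have [Mk _ kM] := cts_bounded cX ck.
have : mean mu (fun x => `|b n x - k x|) @[n --> \oo] -->
    mean mu (fun x => `|f (p x) - k x|).
  apply: (@mean_cvg _ _ mu (fun n x => `|b n x - k x|) _ (Mf + Mk)).
  - by move=> n; exact: cts_dist.
  - apply: cts_borelR; apply: (@cts_dist _ _ (f \o p)) => //.
    by apply: cts_comp => //; exact: ctsE.
  - move=> n x; rewrite normr_id (le_trans (ler_normB _ _))// lerD//.
    by have [i _ <-] := bA n; exact: fM.
  - by move=> x; apply: cvg_norm; apply: cvgB; [exact: bcvg|exact: cvg_cst].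
move=> /cvgrPdist_lt/(_ e e0)/filter_ex[n].
by have [i nDi <-] := bA n => ?; exfalso; exact: nDi.
Qed.

(** For [f >= 0] the case [k = 0] of [mean_dist_cvg] is convergence of the means themselves, and
    these are constant along the action. *)
Lemma mean_envelope_ge0 (f : X -> R) p : continuous f -> (forall x, 0 <= f x) ->
  E p -> mean mu (f \o p) = mean mu f.
Proof.
move=> cf f0 Ep; have [F [FU Fp]] := envelope_net Ep.
have c0 : continuous (fun _ : X => 0 : R) by exact: cst_continuous.
have := mean_dist_cvg FU (@envelope_act _ _ phi) Ep Fp cf c0.
have absf (q : X -> X) : (fun x => `|f (q x) - 0|) = f \o q.
  by apply/funext => x; rewrite subr0 ger0_norm.
under eq_fun do rewrite absf (mean_act cX mu_inv)//.
rewrite absf => cvg1; apply: (cvg_fmap_unique (@Rhausdorff R) _ cvg1).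
exact: cvg_cst.
Qed.

(** Adding a bound of [f] reduces this to the nonnegative case. *)
Lemma mean_envelope (f : X -> R) p : continuous f -> E p ->
  mean mu (f \o p) = mean mu f.
Proof.
move=> cf Ep; have [M _ fM] := cts_bounded cX cf.
have cM : continuous (fun _ : X => M : R) by exact: cst_continuous.
have := @mean_envelope_ge0 (fun x => f x + M) p _ _ Ep.
rewrite (meanD cX mu (cts_comp (ctsE Ep) cf) cM) (meanD cX mu cf cM).
move=> /(_ _ _)/addIr; apply.
  by move=> x; apply: cvgD; [exact: cf|exact: cM].
by move=> x; have := fM x; rewrite ler_norml => /andP[]; lra.
Qed.

Definition distE (f : X -> R) (p q : X -> X) : R :=
  mean mu (fun x => `|f (p x) - f (q x)|).

Lemma distE_right f p q r : continuous f -> E p -> E q -> E r ->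
  distE f (p \o r) (q \o r) = distE f p q.
Proof.
move=> cf Ep Eq Er; apply: (mean_envelope (f := fun x => `|f (p x) - f (q x)|)) => //.
by apply: (@cts_dist _ _ (f \o p) (f \o q)); apply: cts_comp => //; exact: ctsE.
Qed.

(** If [p x] and [q x] differ, some continuous [f] separates them, and full support of [mu] makes
    the distance positive. *)
Lemma distE_eq0 p q : E p -> E q ->
  (forall f : X -> R, continuous f -> distE f p q = 0) -> p = q.
Proof.
move=> Ep Eq d0; apply/funext => x.
apply: (@cvg_fmap_unique _ \oo _ (fun=> p x)) => //; first exact: cvg_cst.
apply: (@completely_regular_cvg R _ cX hX) => f cf.
suff -> : f (p x) = f (q x) by exact: cvg_cst.
apply/eqP; rewrite -subr_eq0 -normr_le0 leNgt; apply/negP => fpq.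
have := @mean_gt0 _ _ _ phi mu cX mu_inv (fun x => `|f (p x) - f (q x)|) x min_phi.
rewrite [mean _ _]d0// ltxx => H; suff : false by []; apply: H => //.
by apply: (@cts_dist _ _ (f \o p) (f \o q)); apply: cts_comp => //; exact: ctsE.
Qed.

Lemma distE_self f p : distE f p p = 0.
Proof.
rewrite /distE; under eq_fun do rewrite subrr normr0.
exact: mean_cst.
Qed.

Lemma distEC f p q : distE f p q = distE f q p.
Proof. by congr mean; apply/funext => x; rewrite distrC. Qed.

Lemma distE_triangle f p q r : continuous f -> E p -> E q -> E r ->
  distE f p r <= distE f p q + distE f q r.
Proof.
move=> cf Ep Eq Er.
have cfE s : E s -> continuous (f \o s) by move=> Es; apply: cts_comp => //; exact: ctsE.
have cd s t Es Et := @cts_dist _ _ (f \o s) (f \o t) (cfE s Es) (cfE t Et).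
rewrite /distE -meanD//; [|exact: cd..]; apply: le_mean => //; [exact: cd| |].
  by move=> x; apply: cvgD; exact: cd.
by move=> x; rewrite ler_distD.
Qed.

Lemma distE_cvg (I : Type) (F : set_system I) (a : I -> X -> X) (p q : X -> X)
    (f : X -> R) :
  UltraFilter F -> (forall i, E (a i)) -> E p -> E q -> ptcvg F a p -> continuous f ->
  distE f (a i) q @[i --> F] --> distE f p q.
Proof.
move=> FU Ea Ep Eq ap cf; apply: (@mean_dist_cvg _ _ _ _ f (f \o q)) => //.
by apply: cts_comp => //; exact: ctsE.
Qed.

Lemma envelope_left_inverse p : E p -> exists2 q, E q & q \o p = id.
Proof.
(* For [c] a cluster point of the powers of [p], right invariance gives
   [d_f(p^(n-m), id) = d_f(p^n, p^m)], which tends to [d_f(c, c) = 0] when first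
   [n] and then [m] tend to infinity. *)
move=> Ep; pose pw n := iter n (fun q : X -> X => q \o p) id.
have Epw n : E (pw n).
  elim: n => [|n IH] /=; [exact: envelope_id|exact: (envelopeM IH Ep)].
have pwD m n : pw (m + n)%N = pw m \o pw n.
  elim: n => [|n IH]; first by rewrite addn0.
  by rewrite addnS /= IH.
have [F [FU Foo]] := ultraFilterLemma eventually_filter.
have [c Ec pwc] := envelope_ultra cX FU Epw.
have /choice[s sP] : forall m, exists s, E s /\ ptcvg F (fun n => pw (n - m.+1)%N) s.
  move=> m; have [s Es ps] := envelope_ultra cX FU (fun n => Epw (n - m.+1)%N).
  by exists s.
have [q Eq sq] := envelope_ultra cX FU (fun m => proj1 (sP m)).
exists q => //; apply: distE_eq0.
- exact: envelopeM.
- exact: envelope_id.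
move=> f cf.
have dsm m : distE f (s m \o p) id = distE f c (pw m).
  have Eid := @envelope_id _ _ phi.
  have dist_pw n : (m < n)%N ->
      distE f (pw n) (pw m) = distE f (pw (n - m.+1)%N \o p) id.
    move=> mn; rewrite -[RHS](@distE_right f _ _ (pw m) cf _ Eid (Epw m)).
      by congr distE; rewrite -[in LHS](subnK mn) -[in LHS](add1n m) !pwD.
    exact: envelopeM (Epw _) Ep.
  apply: (@cvg_fmap_unique _ F _ (fun n => distE f (pw (n - m.+1)%N \o p) id)).
  - exact: Rhausdorff.
  - apply: distE_cvg => //.
    + by move=> n; exact: envelopeM.
    + by apply: envelopeM => //; exact: (proj1 (sP m)).
    + by move=> x; exact: (proj2 (sP m)).
  - have := distE_cvg FU Epw Ec (Epw m) pwc cf.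
    apply: cvg_trans; apply: near_eq_cvg; apply: Foo; near=> n.
    rewrite dist_pw//; near: n; exact: nbhs_infty_gt.
apply: (@cvg_fmap_unique _ F _ (fun m => distE f (s m \o p) id)).
- exact: Rhausdorff.
- apply: distE_cvg => //; try exact: envelope_id.
  + by move=> n; apply: envelopeM => //; exact: (proj1 (sP n)).
  + exact: envelopeM.
  + by move=> x; exact: sq.
- under eq_fun do rewrite dsm distEC.
  by rewrite -(distE_self f c); exact: distE_cvg.
Unshelve. all: by end_near. Qed.

(** If [q] is a left inverse of [p] and [r] one of [q], then [r = r \o q \o p = p]. *)
Lemma envelope_inverse p : E p -> exists q, [/\ E q, q \o p = id & p \o q = id].
Proof.
move=> /[dup] Ep /envelope_left_inverse[q Eq qp]; exists q; split => //.
have [r Er rq] := envelope_left_inverse Eq.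
suff <- : r = p by [].
apply/funext => x; have /= <- := congr1 (@^~ (p x)) rq.
by have /= -> := congr1 (@^~ x) qp.
Qed.

(** The triangle inequality through [p \o b i] and right invariance bound the distance from
    [a i \o b i] to [p \o q] by [distE f (a i) p + distE (f \o p) (b i) q], and both terms tend to
    0. *)
Lemma envelope_joint_cvg (I : Type) (F : set_system I) (a b : I -> X -> X)
    (p q : X -> X) :
  UltraFilter F -> (forall i, E (a i)) -> (forall i, E (b i)) ->
  ptcvg F a p -> ptcvg F b q -> ptcvg F (fun i => a i \o b i) (p \o q).
Proof.
move=> FU Ea Eb ap bq.
have Ep : E p by exact: envelope_closed Ea ap.
have Eq : E q by exact: envelope_closed Eb bq.
have Eab i : E (a i \o b i) by exact: envelopeM (Ea i) (Eb i).
have Epq : E (p \o q) by exact: envelopeM Ep Eq.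
have [s Es abs] := envelope_ultra cX FU Eab.
suff <- : s = p \o q by [].
apply: distE_eq0 => // f cf.
have cfp : continuous (f \o p) by apply: cts_comp => //; exact: ctsE.
apply: (@cvg_fmap_unique _ F _ (fun i => distE f (a i \o b i) (p \o q))).
- exact: Rhausdorff.
- exact: distE_cvg.
have : distE f (a i) p + distE (f \o p) (b i) q @[i --> F] --> (0 : R).
  rewrite -[X in _ --> X](addr0 0); apply: cvgD.
    by rewrite -(distE_self f p); exact: distE_cvg.
  by rewrite -(distE_self (f \o p) q); exact: distE_cvg.
apply: squeeze_cvgr; last exact: cvg_cst.
apply: nearW => i; rewrite Rintegral_ge0//=.
have Epb : E (p \o b i) by exact: envelopeM Ep (Eb i).
by rewrite (le_trans (distE_triangle cf (Eab i) Epb Epq))// distE_right.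
Qed.

(** By transitivity [u i = b i point] with [b i] in [E], which turns the claim into joint continuity
    of composition. *)
Lemma envelope_act_cvg (I : Type) (F : set_system I) (a : I -> X -> X)
    (p : X -> X) (u : I -> X) (x : X) :
  UltraFilter F -> (forall i, E (a i)) -> ptcvg F a p -> u @ F --> x ->
  a i (u i) @[i --> F] --> p x.
Proof.
move=> FU Ea ap ux.
have /choice[b bP] : forall i, exists b, E b /\ b point = u i.
  by move=> i; have [b Eb bu] := envelope_transitive cX hX point (u i) min_phi; exists b.
have [q Eq bq] := envelope_ultra cX FU (fun i => proj1 (bP i)).
have <- : q point = x.
  apply: (cvg_fmap_unique hX _ (bq point)).
  by under eq_fun do rewrite (proj2 (bP _)).
have := @envelope_joint_cvg _ F a b p q FU Ea (fun i => proj1 (bP i)) ap bq point.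
by rewrite /=; under eq_fun do rewrite (proj2 (bP _)).
Qed.

End envelope_group.

(** * Equicontinuity and averages over the envelope *)

Lemma sumr_le_rem (R : realType) (I : eqType) (s : seq I) (h : I -> R) (i : I)
    (M K : R) : i \in s -> (forall j, j \in s -> h j <= M) -> h i <= K ->
  \sum_(j <- s) h j <= (size s)%:R * M - M + K.
Proof.
move=> si hM hK; rewrite (big_rem i)//=.
have -> : (size s)%:R * M - M = (size (rem i s))%:R * M.
  rewrite size_rem//; case: s si {hM} => // j s _ /=.
  by rewrite -natr1 mulrDl mul1r addrK.
rewrite addrC lerD//.
elim: (rem i s) (@mem_rem _ i s) => [|j t IH] st; first by rewrite big_nil mul0r.
rewrite big_cons /= -natr1 mulrDl mul1r addrC lerD//; last first.
  by apply: hM; apply: st; rewrite mem_head.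
by apply: IH => k kt; apply: st; rewrite in_cons kt orbT.
Qed.

Section envelope_averages.
Context (R : realType) (T : topologicalMonoidType) (X : ptopologicalType).
Context (phi : semiflow T X) (mu : probability (borel X) R).
Hypothesis cX : compact [set: X].
Hypothesis hX : hausdorff_space X.
Hypothesis min_phi : minimal phi.
Hypothesis wap_phi : weakly_almost_periodic phi R.
Hypothesis mu_inv : invariant_measure phi mu.

Local Notation E := (envelope phi).

Let ctsE p : E p -> continuous p.
Proof. exact: envelope_cts. Qed.

Let act_cvg := @envelope_act_cvg R T X phi mu cX hX min_phi wap_phi mu_inv.

(** Otherwise there are points [y] tending to [x0] and maps [q y], convergent by compactness of [E],
    whose values at [y] and [x0] stay [e] apart under [f]; this contradicts joint continuity. *)
Lemma envelope_equicontinuous (f : X -> R) (x0 : X) (e : R) :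
  continuous f -> 0 < e ->
  nbhs x0 [set y | forall q, E q -> `|f (q y) - f (q x0)| < e].
Proof.
move=> cf e0; apply: contrapT => /ultra_setC[G [GU x0G GnB]].
have /choice[q qP] : forall y, exists q, E q /\
    (~ (forall q, E q -> `|f (q y) - f (q x0)| < e) -> e <= `|f (q y) - f (q x0)|).
  move=> y; have [|/existsNP[q /not_implyP[Eq qe]]] :=
    pselect (forall q, E q -> `|f (q y) - f (q x0)| < e).
    by move=> H; exists id; split=> //; exact: envelope_id.
  by exists q; split=> // _; rewrite leNgt; apply/negP.
have Eq y : E (q y) by exact: (proj1 (qP y)).
have [q0 Eq0 qq0] := envelope_ultra cX GU Eq.
have cvg1 : f (q y y) @[y --> G] --> f (q0 x0).
  by apply: continuous_cvg_fmap cf _; apply: act_cvg.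
have cvg2 : f (q y x0) @[y --> G] --> f (q0 x0) by exact: continuous_cvg_fmap cf (qq0 x0).
have : f (q y y) - f (q y x0) @[y --> G] --> f (q0 x0) - f (q0 x0) by exact: cvgB.
rewrite subrr => /cvgr0Pnorm_lt/(_ e e0) Ge.
have /filter_ex[y [yB]] : G (~` [set y | forall q, E q -> `|f (q y) - f (q x0)| < e] `&`
  [set y | `|f (q y y) - f (q y x0)| < e]) by exact: filterI.
by rewrite /= ltNge => /negP; apply; apply: (proj2 (qP y)).
Qed.

(** Each [y] is sent to [x0] by some map of [E]; pull the equicontinuity neighbourhood of [x0] back
    along these maps and take a finite subcover. *)
Lemma envelope_cover (f : X -> R) (x0 : X) (e : R) : continuous f -> 0 < e ->
  exists2 s : seq (X -> X), (forall p, p \in s -> E p) &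
    forall x, exists2 p, p \in s & forall q, E q -> `|f (q (p x)) - f (q x0)| < e.
Proof.
move=> cf e0.
have /choice[p pP] : forall y, exists p, E p /\ p y = x0.
  by move=> y; have [p Ep py] := envelope_transitive cX hX y x0 min_phi; exists p.
have [|s sP] := @finite_subcover _ cX
  (fun y => p y @^-1` [set x | forall q, E q -> `|f (q x) - f (q x0)| < e]).
  move=> y; apply: (ctsE (proj1 (pP y))); rewrite (proj2 (pP y)).
  exact: envelope_equicontinuous.
exists [seq p y | y <- s] => [_ /mapP[y _ ->]|x]; first exact: (proj1 (pP y)).
by have [y ys yx] := sP x; exists (p y) => //; exact: map_f.
Qed.

Lemma average_cts (s : seq (X -> X)) (g : X -> R) :
  continuous g -> (forall p, p \in s -> E p) ->
  continuous (fun x => \sum_(p <- s) g (p x)).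
Proof.
move=> cg; elim: s => [|p s IH] sE.
  by under eq_fun do rewrite big_nil; exact: cst_continuous.
under eq_fun do rewrite big_cons.
move=> x; apply: cvgD.
  by apply: (cts_comp _ cg); apply: ctsE; apply: sE; rewrite mem_head.
by apply: IH => q qs; apply: sE; rewrite in_cons qs orbT.
Qed.

Lemma mean_average (s : seq (X -> X)) (g : X -> R) :
  continuous g -> (forall p, p \in s -> E p) ->
  mean mu (fun x => \sum_(p <- s) g (p x)) = (size s)%:R * mean mu g.
Proof.
move=> cg; elim: s => [|p s IH] sE.
  by under eq_fun do rewrite big_nil; rewrite mean_cst mul0r.
have Ep : E p by apply: sE; rewrite mem_head.
have sE' q : q \in s -> E q by move=> qs; apply: sE; rewrite in_cons qs orbT.
under eq_fun do rewrite big_cons.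
rewrite (meanD cX mu (cts_comp (ctsE Ep) cg) (average_cts cg sE')) IH//.
by rewrite (mean_envelope cX hX wap_phi mu_inv)//= -natr1 mulrDl mul1r addrC.
Qed.

End envelope_averages.

(** * Independence of the mean from the invariant measure *)

Section unique_mean.
Context (R : realType) (T : topologicalMonoidType) (X : ptopologicalType).
Context (phi : semiflow T X).
Hypothesis cX : compact [set: X].
Hypothesis hX : hausdorff_space X.
Hypothesis min_phi : minimal phi.
Hypothesis wap_phi : weakly_almost_periodic phi R.

Local Notation E := (envelope phi).

Lemma le_mean_invariant (mu nu : probability (borel X) R) (f : X -> R) :
  invariant_measure phi mu -> invariant_measure phi nu -> continuous f ->
  mean mu f <= mean nu f.
Proof.
move=> mu_inv nu_inv cf; apply/ler_addgt0Pr => e' e'0.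
pose e := e' / 2; have e0 : 0 < e by rewrite divr_gt0.
have -> : e' = 2 * e by rewrite /e; lra.
have [s sE sP] := envelope_cover cX hX min_phi wap_phi mu_inv point cf e0.
have N0 : 0 < (size s)%:R :> R.
  by have [p ps _] := sP point; rewrite ltr0n; case: s ps {sE sP}.
(* [H] contains the convex hull of the [f \o p]. Averaging a nearly minimal
   [g] of [H] over [s] lowers its upper bound unless [g] is nearly constant. *)
pose H := [set g : X -> R | [/\ continuous g, mean mu g = mean mu f,
  mean nu g = mean nu f & forall x y,
  (forall q, E q -> `|f (q x) - f (q y)| < e) -> `|g x - g y| <= e]].
pose S := [set M : R | exists2 g, H g & forall x, g x <= M].
have cst_cts (r : R) : continuous (fun _ : X => r) by exact: cst_continuous.
have lbS : lbound S (mean mu f).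
  move=> M [g [cg <- _ _] gM]; rewrite -(mean_cst mu M).
  exact: le_mean.
have S0 : S !=set0.
  have [M _ fM] := cts_bounded cX cf.
  exists M, f; last by move=> x; exact: le_trans (ler_norm _) (fM x).
  by split=> // x y fxy; exact/ltW/(fxy id (@envelope_id _ _ phi)).
have infS : has_inf S by split=> //; exists (mean mu f).
(* The tolerance is divided by [size s] because the bound for the average is later multiplied by
   [size s]; the loss is then a single [e]. *)
have [|M [g Hg gM] Mc] := @inf_adherent _ S (e / (size s)%:R) _ infS; first exact: divr_gt0.
have cM : inf S <= M by apply: ge_inf; [exact: (proj2 infS)|exists g].
have [cg mug nug lipg] := Hg.
have fc : mean mu f <= inf S by exact: lb_le_inf.
(* Integrating this lower bound against [nu] gives the claim, as [mean mu f <= inf S] and [g] has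
   the same [nu]-mean as [f]. *)
suff gc x1 : inf S - 2 * e <= g x1.
  have := le_mean cX nu (cst_cts (inf S - 2 * e)) cg gc.
  by rewrite mean_cst nug; lra.
have [r Er rx1] := envelope_transitive cX hX point x1 min_phi.
have rsE p : p \in [seq r \o p | p <- s] -> E p.
  by move=> /mapP[q qs ->]; apply: envelopeM => //; exact: sE.
(* For every [x] some [p] in [s] brings [x] close to [point] uniformly along [E], so the term of
   [r \o p] is at most [g x1 + e] while the others are at most [M]. The resulting bound cannot fall
   below [inf S], which forces [g x1] up. *)
pose g' x := (size s)%:R^-1 * \sum_(p <- [seq r \o p | p <- s]) g (p x).
have cs := average_cts cX hX wap_phi cg rsE.
have szs : size [seq r \o p | p <- s] = size s by rewrite size_map.
have : S ((size s)%:R^-1 * ((size s)%:R * M - M + (g x1 + e))).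
  exists g'; last first.
    move=> x; rewrite ler_pM2l ?invr_gt0// -szs.
    have [p ps px] := sP x; apply: (@sumr_le_rem _ _ _ _ (r \o p)).
    - exact: map_f.
    - by move=> q _; exact: gM.
    - rewrite -lerBlDl (le_trans (ler_norm _))//= -rx1 lipg// => q Eq.
      by apply: (px (q \o r)); exact: envelopeM.
  split.
  - by move=> x; apply: cvgM; [exact: cvg_cst|exact: cs].
  - by rewrite meanZ// (mean_average cX hX wap_phi mu_inv)// szs mulKf// gt_eqF.
  - by rewrite meanZ// (mean_average cX hX wap_phi nu_inv)// szs mulKf// gt_eqF.
  (* Closeness of [x] and [y] along all of [E] passes to their images under any map of [E], so each
     term of the average varies by at most [e]. *)
  - move=> x y xy; rewrite /g' -mulrBr -sumrB normrM ger0_norm ?invr_ge0//.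
    rewrite ler_pdivrMl// -szs (le_trans (ler_norm_sum _ _ _))//.
    elim: [seq _ | _ <- s] rsE => [|p t IH] tE; first by rewrite big_nil mul0r.
    rewrite big_cons /= -natr1 mulrDl mul1r addrC lerD//.
      by apply: IH => q qt; apply: tE; rewrite in_cons qt orbT.
    apply: lipg => q Eq; apply: (xy (q \o p)); apply: envelopeM => //.
    by apply: tE; rewrite mem_head.
move=> /(ge_inf (proj2 infS)).
rewrite ler_pdivlMl// => Nc.
move: Mc; rewrite -ltrBlDl ltr_pdivlMr// => Mc.
by nra.
Qed.

Lemma eq_mean_invariant (mu nu : probability (borel X) R) (f : X -> R) :
  invariant_measure phi mu -> invariant_measure phi nu -> continuous f ->
  mean mu f = mean nu f.
Proof. by move=> *; apply/eqP; rewrite eq_le !le_mean_invariant. Qed.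

End unique_mean.

(** * Measures of increasing unions and null differences *)

Section measure_limits.
Context d (Y : measurableType d) (R : realType) (P : {measure set Y -> \bar R}).

Lemma le_measure_setU_negligible (A B C : set Y) :
  measurable A -> measurable B -> P.-negligible C -> A `<=` B `|` C ->
  (P A <= P B)%E.
Proof.
move=> mA mB [C' [mC' C'0 CC']] ABC.
have -> : P B = P (B `|` C').
  apply/eqP; rewrite eq_le le_measure ?inE//=; [|exact: measurableU].
  by apply: (le_trans (measureU2 P mB mC')); rewrite [X in (_ + X <= _)%E]C'0 adde0.
apply: le_measure; rewrite ?inE//; first exact: measurableU.
by move=> x /ABC[]; [left|right; exact: CC'].
Qed.

Lemma bigcup_measure_le (G : (set Y)^nat) (s : \bar R) :
  (forall n, measurable (G n)) -> nondecreasing_seq G ->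
  (forall n, P (G n) <= s)%E -> (P (\bigcup_n G n) <= s)%E.
Proof.
move=> mG ndG Gs; have mU : measurable (\bigcup_n G n) by exact: bigcup_measurable.
by apply: (cvge_le _ (nondecreasing_cvg_mu mG mU ndG)); exact: nearW.
Qed.

(** The difference of [A] and [G n] has measure [P (A U G n) - P (G n)], at most [1 / (n + 1)]. *)
Lemma negligible_setD_bigcup (A : set Y) (G : (set Y)^nat) :
  fin_num_fun P -> measurable A -> (forall n, measurable (G n)) ->
  (forall n, P (A `|` G n) <= P (G n) + (n.+1%:R^-1)%:E)%E ->
  P.-negligible (A `\` \bigcup_n G n).
Proof.
move=> finP mA mG AG; have mU : measurable (\bigcup_n G n) by exact: bigcup_measurable.
have mD := measurableD mA mU; apply/(negligibleP _ mD).
have Dn n : (P (A `\` \bigcup_n G n) <= (n.+1%:R^-1)%:E)%E.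
  apply: (@le_trans _ _ (P (A `\` G n))).
    apply: le_measure; rewrite ?inE//; first exact: measurableD.
    by move=> x [Ax nGx]; split=> // Gx; apply: nGx; exists n.
  have finG : P (G n) \is a fin_num by exact: finP.
  rewrite -(leeD2lE _ _ finG).
  apply: le_trans (AG n); rewrite -measureU//; last 2 first.
  - exact: measurableD.
  - by apply/seteqP; split=> x // [Gx [_ /(_ Gx)]].
  apply: le_measure; rewrite ?inE//; [|exact: measurableU|].
  - by apply: measurableU => //; exact: measurableD.
  - by move=> x [Gx|[Ax _]]; [right|left].
apply/eqP; rewrite eq_le measure_ge0 andbT; apply/lee_addgt0Pr => e e0.
rewrite add0e; near \oo => n; rewrite (le_trans (Dn n))// lee_fin ltW//.
by near: n; exact: near_infty_natSinv_lt (PosNum e0).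
Unshelve. all: by end_near. Qed.

End measure_limits.

(** * Inner approximation of open sets by cozero sets *)

Section completion_regularity.
Context (R : realType) (T : topologicalMonoidType) (X : ptopologicalType).
Context (phi : semiflow T X) (mu : probability (borel X) R).
Hypothesis cX : compact [set: X].
Hypothesis hX : hausdorff_space X.
Hypothesis min_phi : minimal phi.
Hypothesis wap_phi : weakly_almost_periodic phi R.
Hypothesis mu_inv : invariant_measure phi mu.

Local Notation E := (envelope phi).

Let ctsE p : E p -> continuous p.
Proof. exact: envelope_cts. Qed.

Let act_cvg := @envelope_act_cvg R T X phi mu cX hX min_phi wap_phi mu_inv.

Let inverse := @envelope_inverse R T X phi mu cX hX min_phi wap_phi mu_inv.

Lemma cozero_envelope (g : X -> R) p : continuous g -> E p ->
  mu (cozero (g \o p)) = mu (cozero g).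
Proof.
move=> cg Ep; apply: eq_cozero => // [|u cu].
  by apply: cts_comp => //; exact: ctsE.
by rewrite compA (mean_envelope cX hX wap_phi mu_inv)//; exact: cts_comp.
Qed.

(** Points [u i] witnessing failure would converge along [F], and joint continuity makes
    [g (q i (u i)) - g (u i)] tend to 0. *)
Lemma envelope_cvg_id_uniform (I : Type) (F : set_system I) (q : I -> X -> X)
    (g : X -> R) (e : R) :
  UltraFilter F -> (forall i, E (q i)) -> ptcvg F q id -> continuous g -> 0 < e ->
  F [set i | forall x, `|g (q i x) - g x| < e].
Proof.
move=> FU Eq qid cg e0; set D := [set i | _].
have [//|FnD] := in_ultra_setVsetC D FU; exfalso.
have /choice[u uP] : forall i, exists x, ~ D i -> e <= `|g (q i x) - g x|.
  move=> i; have [Di|/existsNP[x xP]] := pselect (D i); first by exists point.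
  by exists x => _; rewrite leNgt; apply/negP.
have [x ux] := compact_ultra_cvg u cX FU.
have cvg1 : g (q i (u i)) @[i --> F] --> g x.
  by apply: continuous_cvg_fmap cg _; apply: (act_cvg (p := id)).
have : g (q i (u i)) - g (u i) @[i --> F] --> g x - g x.
  by apply: cvgB => //; exact: continuous_cvg_fmap cg ux.
rewrite subrr => /cvgr0Pnorm_lt/(_ e e0) Fe.
have /filter_ex[i [nDi]] : F (~` D `&` [set i | `|g (q i (u i)) - g (u i)| < e]).
  exact: filterI.
by rewrite /= ltNge uP.
Qed.

Section countable_family.
Variable g : nat -> X -> R.
Hypothesis cg : forall k, continuous (g k).

Definition stabilizer : set (X -> X) := [set p | E p /\ forall k, g k \o p = g k].

Definition near_stabilizer k : set (X -> X) :=
  [set p | E p /\ forall j, (j <= k)%N -> forall x, `|g j (p x) - g j x| < k.+1%:R^-1].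

Variable U : set X.
Hypothesis oU : open U.

(* The complement of the saturation of [U] under the stabilizer. *)
Definition unsaturated : set X := [set x | forall n, stabilizer n -> ~ U (n x)].

(** The interiors of these sets contain [unsaturated] and intersect in it, so their complements are
    countably many compact sets with union the saturation of [U]. *)
Definition near_unsaturated k : set X :=
  [set x | exists2 p, near_stabilizer k p & unsaturated (p x)].

(** A point [y] near [z] is [q y z] with [q y] near the identity, hence nearly stabilizing the
    [g j]; so does its inverse, which carries [y] back to [z]. *)
Lemma nbhs_near_unsaturated k z : unsaturated z -> nbhs z (near_unsaturated k).
Proof.
move=> Zz; apply: contrapT => /ultra_setC[G [GU zG GnB]].
have /choice[r rP] : forall y, exists r, E r /\ r z = y.
  by move=> y; have [r Er rz] := envelope_transitive cX hX z y min_phi; exists r.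
have [r0 Er0 rr0] := envelope_ultra cX GU (fun y => proj1 (rP y)).
have r0z : r0 z = z.
  apply: (cvg_fmap_unique hX _ (rr0 z)).
  by under eq_fun do rewrite (proj2 (rP _)); exact: zG.
have [r0' [Er0' r0'r0 r0r0']] := inverse Er0.
(* The limit [r0] fixes [z] but may differ from the identity; dividing by it makes [q y] tend to the
   identity and keeps [q y z = y]. *)
pose q y := r y \o r0'.
have Eq y : E (q y) by exact: envelopeM (proj1 (rP y)) Er0'.
have qz y : q y z = y.
  rewrite /q /= -{1}r0z; have /= -> := congr1 (@^~ z) r0'r0.
  exact: (proj2 (rP y)).
have qid : ptcvg G q id.
  by move=> x; have /= {2}<- := congr1 (@^~ x) r0r0'; exact: rr0.
have Gq : G [set y | forall j, j \in iota 0 k.+1 ->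
    forall x, `|g j (q y x) - g j x| < k.+1%:R^-1].
  apply: filter_all_in => j _.
  by apply: (envelope_cvg_id_uniform GU Eq qid (@cg j)); rewrite invr_gt0.
have [y [nBy qy]] := filter_ex (filterI GnB Gq).
apply: nBy; have [p [Ep pq qp]] := inverse (Eq y).
exists p; last by rewrite -{1}(qz y); have /= -> := congr1 (@^~ z) pq.
split=> // j jk x; have /= {2}<- := congr1 (@^~ x) qp.
by rewrite distrC; apply: qy; rewrite mem_iota.
Qed.

(** A limit [q] of the witnesses [p k] stabilizes every [g j]. As [U] is open, [q x] is again
    unsaturated, and the inverse of [q] transfers this to [x]. *)
Lemma bigcap_near_unsaturated x :
  (forall k, near_unsaturated k x) -> unsaturated x.
Proof.
move=> Ox; have /choice[p pP] : forall k, exists p,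
    near_stabilizer k p /\ unsaturated (p x).
  by move=> k; have [p Np Zp] := Ox k; exists p.
have [F [FU Foo]] := ultraFilterLemma eventually_filter.
have Ep k : E (p k) by exact: (proj1 (proj1 (pP k))).
have [q Eq pq] := envelope_ultra cX FU Ep.
have gq j : g j \o q = g j.
  apply/funext => y; apply: (@cvg_fmap_unique _ F _ (fun k => g j (p k y))).
  - exact: Rhausdorff.
  - exact: continuous_cvg_fmap (pq y).
  - apply/cvgrPdist_lt => e e0; apply: Foo; near=> k.
    rewrite distrC; apply: (@lt_trans _ _ k.+1%:R^-1).
      by apply: (proj2 (proj1 (pP k))); near: k; exact: nbhs_infty_ge.
    by near: k; exact: near_infty_natSinv_lt (PosNum e0).
have [q' [Eq' q'q qq']] := inverse Eq.
have gq' j : g j \o q' = g j by rewrite -[in LHS](gq j) -compA qq'.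
have Zqx : unsaturated (q x).
  move=> n [En gn] Unqx.
  have : n (p k x) @[k --> F] --> n (q x).
    by apply: continuous_cvg_fmap (pq x); exact: ctsE.
  move=> /(_ U (open_nbhs_nbhs (conj oU Unqx))) FUn.
  have /filter_ex[k Uk] : F [set k | U (n (p k x))] by exact: FUn.
  exact: (proj2 (pP k) n).
move=> n [En gn] Unx; apply: (Zqx (n \o q')).
  by split=> [|j]; [exact: envelopeM|rewrite compA gn gq'].
by rewrite /=; have /= -> := congr1 (@^~ x) q'q.
Unshelve. all: by end_near. Qed.

End countable_family.

Lemma cozero_inner_regular (U : set X) (r : R) : open U -> (r%:E < mu U)%E ->
  exists g : X -> R, [/\ continuous g, cozero g `<=` U & (r%:E < mu (cozero g))%E].
Proof.
move=> oU rU.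
pose S := [set fine (mu (cozero g)) |
  g in [set g : X -> R | continuous g /\ cozero g `<=` U]].
have finmu (g : X -> R) : continuous g -> (fine (mu (cozero g)))%:E = mu (cozero g).
  by move=> cg; apply: fineK; apply: fin_num_measure; exact: cozero_borel.
have supS : has_sup S.
  split.
    exists (fine (mu (cozero (fun=> 0 : R)))), (fun=> 0) => //.
    by split; [exact: cst_continuous|move=> x; rewrite /cozero /= ltxx].
  exists 1 => _ [g [cg _] <-]; rewrite -lee_fin finmu//.
  by apply: probability_le1; exact: cozero_borel.
pose s := sup S.
have le_s (g : X -> R) : continuous g -> cozero g `<=` U -> (mu (cozero g) <= s%:E)%E.
  move=> cg gU; rewrite -finmu// lee_fin; apply: ub_le_sup; first exact: (proj2 supS).
  by exists g.
(* It remains to see that cozero subsets exhaust the measure of [U]. *)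
suff Us : (mu U <= s%:E)%E.
  have [_ [g [cg gU] <-]] : exists2 y, S y & r < y.
    by apply: sup_gt; [exact: (proj1 supS)|rewrite -lte_fin; exact: lt_le_trans Us].
  by rewrite -lte_fin finmu// => rg; exists g.
have /choice[h hP] : forall n, exists h : X -> R, [/\ continuous h, cozero h `<=` U &
    (s%:E <= mu (cozero h) + (n.+1%:R^-1)%:E)%E].
  move=> n; have [|_ [h [ch hU] <-]] := @sup_adherent _ S n.+1%:R^-1 _ supS.
    by rewrite invr_gt0.
  rewrite -/s => sh; exists h; split=> //.
  by rewrite -finmu// -EFinD lee_fin -lerBlDr ltW.
pose g := fix g n : X -> R := if n is m.+1 then g m \max h n else h 0%N.
have cg n : continuous (g n).
  elim: n => [|n IH]; first by have [] := hP 0%N.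
  by apply: cts_max => //; have [] := hP n.+1.
have gU n : cozero (g n) `<=` U.
  elim: n => [|n IH]; first by have [] := hP 0%N.
  by rewrite /= cozero_max subUset; split=> //; have [] := hP n.+1.
have hg n : cozero (h n) `<=` cozero (g n).
  by case: n => // n; rewrite /= cozero_max; exact: subsetUr.
pose G n : set (borel X) := cozero (g n).
have mG n : measurable (G n) by exact: cozero_borel.
have ndG : nondecreasing_seq G.
  by apply/nondecreasing_seqP => n; apply/subsetPset; rewrite /G /= cozero_max; exact: subsetUl.
have Gs n : (mu (G n) <= s%:E)%E by exact: le_s.
have sG n : (s%:E <= mu (G n) + (n.+1%:R^-1)%:E)%E.
  have [ch _ sh] := hP n; apply: (le_trans sh); rewrite leeD2r//.
  by apply: le_measure; rewrite ?inE//; exact: cozero_borel.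
pose V := \bigcup_n G n.
apply: le_trans (bigcup_measure_le mG ndG Gs).
(* Since [n] fixes [g k], joining [cozero (f \o n)] to [G k] gives [cozero ((f \max g k) \o n)]. By
   invariance its measure is that of a cozero subset of [U], so at most [s], and [G k] already
   nearly attains [s]. *)
have null_f (f : X -> R) (n : X -> X) : continuous f -> cozero f `<=` U -> stabilizer g n ->
    mu.-negligible (cozero (f \o n) `\` V).
  move=> cf fU [En gn]; have cfn : continuous (f \o n) by apply: cts_comp => //; exact: ctsE.
  apply: negligible_setD_bigcup => // [|k]; first exact: cozero_borel.
  apply: le_trans (sG k).
  have -> : cozero (f \o n) `|` G k = cozero ((f \max g k) \o n).
    have -> : (f \max g k) \o n = (f \o n) \max g k by rewrite -[in RHS](gn k).
    by rewrite cozero_max.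
  rewrite [leLHS](cozero_envelope (cts_max cf (@cg k)) En).
  by apply: le_s; [exact: cts_max|rewrite cozero_max subUset].
pose O k := (near_unsaturated g U k)^°.
have null_C k : mu.-negligible (~` O k `\` V).
  have /choice[fn fnP] : forall x, exists fn : (X -> R) * (X -> X), ~ O k x ->
      [/\ continuous fn.1, cozero fn.1 `<=` U, stabilizer g fn.2 & cozero (fn.1 \o fn.2) x].
    move=> x; have [Ox|nOx] := pselect (O k x); first by exists (fun=> 0, id).
    have /existsNP[n /not_implyP[Nn /contrapT Unx]] : ~ unsaturated g U x.
      by move=> Zx; apply: nOx; exact: nbhs_near_unsaturated.
    by have [f [cf fU fnx]] := urysohn_point R cX hX oU Unx; exists (f, n).
  (* Adding [O k] itself to the cover of its complement lets compactness of the whole space be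
     used. *)
  pose B x := if pselect (O k x) then O k else cozero ((fn x).1 \o (fn x).2).
  have [|t tP] := @finite_subcover _ cX B.
    move=> x; rewrite /B; case: pselect => [Ox|nOx].
      by apply: open_nbhs_nbhs; split=> //; exact: open_interior.
    have [cf _ [En _] fnx] := fnP x nOx.
    apply: open_nbhs_nbhs; split=> //; apply: cozero_open.
    by apply: cts_comp => //; exact: ctsE.
  apply: (@negligible_seq _ (borel X) R mu X t (fun x => (~` O k `&` B x) `\` V)).
    move=> x _; rewrite /B; case: pselect => [Ox|nOx].
      by rewrite setICl set0D; exact: negligible_set0.
    have [cf fU Nn _] := fnP x nOx.
    by apply: negligibleS (null_f _ _ cf fU Nn) => y [[_ ?] ?].
  by move=> x [nOx nVx]; have [y yt By] := tP x; exists y.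
apply: (@le_measure_setU_negligible _ _ _ mu _ _ (\bigcup_k (~` O k `\` V))).
- exact: open_borel.
- exact: bigcup_measurable.
- exact: negligible_bigcup.
- move=> x Ux; have [Vx|nVx] := pselect (V x); [by left|right].
  (* A point of [U] is not unsaturated, because the identity belongs to the stabilizer. *)
  have /existsNP[k nOx] : ~ forall k, near_unsaturated g U k x.
    move=> /(bigcap_near_unsaturated cg oU)/(_ id); apply=> //.
    by split=> //; exact: envelope_id.
  by exists k => //; split=> // /interior_subset.
Qed.

End completion_regularity.

(** * From continuous functions to open and Borel sets *)

Lemma le_invariant_open (R : realType) (T : topologicalMonoidType)
    (X : ptopologicalType) (phi : semiflow T X) (mu nu : probability (borel X) R)
    (U : set X) :
  compact [set: X] -> hausdorff_space X -> minimal phi ->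
  weakly_almost_periodic phi R -> invariant_measure phi mu ->
  invariant_measure phi nu -> open U -> (mu U <= nu U)%E.
Proof.
move=> cX hX min_phi wap_phi mu_inv nu_inv oU.
(* Otherwise [U] contains a cozero set of [mu]-measure above [nu U]; but [mu] and [nu] agree on
   cozero sets, since they have equal means. *)
rewrite leNgt; apply/negP => nuU.
have finnu : nu U \is a fin_num by apply: fin_num_measure; exact: open_borel.
have [|g [cg gU]] := @cozero_inner_regular _ _ _ _ mu cX hX min_phi wap_phi mu_inv U
  (fine (nu U)) oU; first by rewrite fineK.
rewrite fineK// (@eq_cozero R X mu nu g g cg cg) => [|u cu].
  rewrite ltNge => /negP; apply; apply: le_measure; rewrite ?inE//.
    exact: cozero_borel.
  exact: open_borel.
apply: (eq_mean_invariant cX hX min_phi wap_phi mu_inv nu_inv).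
exact: cts_comp.
Qed.

Theorem theorem3p4 (R : realType) (T : topologicalMonoidType)
    (X : ptopologicalType) (phi : semiflow T X) :
  compact [set: X] -> hausdorff_space X ->
  minimal phi -> weakly_almost_periodic phi R -> amenable R T ->
  (forall t : T, bijective (phi t)) ->
  uniquely_ergodic R phi.
Proof.
move=> cX hX min_phi wap_phi amT _.
have [mu mu_inv] := amT X cX hX phi.
exists mu; split=> // nu nu_inv B mB.
(* Open sets are stable under intersection and generate the Borel sets; the constant sequence [setT]
   is the exhaustion by sets of finite measure. *)
apply: (@measure_unique _ R (borel X) (@open X) (fun=> setT) _ _ _ _ nu mu) => //.
- exact: openI.
- by move=> _; exact: openT.
- by apply/seteqP; split=> // x _; exists 0%N.
- by move=> U oU; apply/eqP; rewrite eq_le; apply/andP; split;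
    apply: le_invariant_open => //; eassumption.
- by move=> _; exact: fin_num_fun_lty.
Qed.
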